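(* Let $\mathfrak{s}$ be a supersolvable Lie algebra over $\mathbb{R}$ of linear transformations of $\mathbb{R}^3$. Then $\mathfrak{s}$ has an eigenvector, i.e. there is a nonzero $u\in\mathbb{R}^3$ that is an eigenvector of every operator in $\mathfrak{s}$.
   Context: A Lie algebra of linear transformations of $\mathbb{R}^3$ is a real linear subspace of $\mathrm{End}_{\mathbb{R}}(\mathbb{R}^3)$ closed under the commutator bracket $[A,B]=AB-BA$. A Lie algebra $\mathfrak{s}$ over a field $\mathsf{f}$ is called supersolvable if for every $A\in\mathfrak{s}$ the spectrum of the linear map $\mathrm{ad}\,A\colon\mathfrak{s}\to\mathfrak{s}$, $X\mapsto[A,X]$, lies in $\mathsf{f}$ (all its eigenvalues in an algebraic closure of $\mathsf{f}$ belong to $\mathsf{f}$); here $\mathsf{f}=\mathbb{R}$. Eigenvectors have real eigenvalues. *)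

(* Defs.v *)
From HB Require Import structures.
From mathcomp Require Export all_boot all_order all_algebra.
From mathcomp Require Export complex.
From mathcomp Require Export reals.

Set Implicit Arguments.
Unset Strict Implicit.
Unset Printing Implicit Defensive.

Import Order.TTheory GRing.Theory Num.Theory.
Local Open Scope ring_scope.
Local Open Scope complex_scope.

Definition lie_bracket (F : fieldType) (vT : vectType F) (A B : 'End(vT)) :
  'End(vT) := (A \o B)%VF - (B \o A)%VF.

Lemma lie_bracketE (F : fieldType) (vT : vectType F) (A B : 'End(vT)) (u : vT) :
  lie_bracket A B u = A (B u) - B (A u).
Proof. by rewrite add_lfunE opp_lfunE !comp_lfunE. Qed.

Definition lie_algebra (F : fieldType) (vT : vectType F)
    (s : {vspace 'End(vT)}) : Prop :=
  forall A B, A \in s -> B \in s -> lie_bracket A B \in s.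

(* When [s] is closed under the bracket and [A \in s], the projection [vsproj s]
   only retypes the bracket as an element of [s]; see [adE]. *)
Definition ad_fun (F : fieldType) (vT : vectType F) (s : {vspace 'End(vT)})
    (A : 'End(vT)) (X : subvs_of s) : subvs_of s :=
  vsproj s (lie_bracket A (vsval X)).

Lemma ad_fun_is_linear (F : fieldType) (vT : vectType F)
    (s : {vspace 'End(vT)}) (A : 'End(vT)) : linear (ad_fun (s := s) A).
Proof.
move=> a X Y; rewrite /ad_fun -linearP; congr (vsproj s _).
rewrite /lie_bracket linearP /= comp_lfunDr comp_lfunDl.
by rewrite -comp_lfunZr -comp_lfunZl scalerBr opprD addrACA.
Qed.

HB.instance Definition _ (F : fieldType) (vT : vectType F)
    (s : {vspace 'End(vT)}) (A : 'End(vT)) :=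
  GRing.isLinear.Build F (subvs_of s) (subvs_of s) _ (ad_fun (s := s) A)
    (ad_fun_is_linear A).

Definition ad (F : fieldType) (vT : vectType F) (s : {vspace 'End(vT)})
    (A : 'End(vT)) : 'End(subvs_of s) := linfun (ad_fun (s := s) A).

Lemma adE (F : fieldType) (vT : vectType F) (s : {vspace 'End(vT)})
    (A : 'End(vT)) (X : subvs_of s) :
  lie_algebra s -> A \in s -> vsval (ad s A X) = lie_bracket A (vsval X).
Proof. by move=> ls sA; rewrite lfunE /= vsprojK // ls // subvsP. Qed.

(* [R[i]] is the algebraic closure of [R]; the eigenvalues of [f] in it are
   those of the matrix of [f] in a basis, with entries embedded in [R[i]]. *)
Definition complex_eigenvalue (R : rcfType) (vT : vectType R) (f : 'End(vT))
    (z : R[i]) : bool :=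
  eigenvalue
    (map_mx (real_complex R) (passmx.mxof (vbasis {:vT}) (vbasis {:vT}) f)) z.

Definition real_spectrum (R : rcfType) (vT : vectType R) (f : 'End(vT)) : Prop :=
  forall z : R[i], complex_eigenvalue f z -> exists r : R, z = r%:C.

Definition supersolvable (R : rcfType) (vT : vectType R)
    (s : {vspace 'End(vT)}) : Prop :=
  forall A, A \in s -> real_spectrum (ad s A).

Definition eigenvector (F : fieldType) (vT : vectType F) (f : 'End(vT))
    (u : vT) : Prop :=
  u != 0 /\ exists a : F, f u = a *: u.

(* Main.v *)
(* For a matrix A in s, write D Y = Y A - A Y; by hypothesis a product of factors
   D - r with r real kills s.
   If some A in s has a non-real eigenvalue, then A is diagonalizable over R[i]
   and two of its eigenvalues differ by a real number only when they are equal.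
   Hence 0 is the only real eigenvalue of the semisimple map D, so s commutes
   with A and preserves its unique real eigenline.
   Otherwise tr (X^2) is a sum of squares of real eigenvalues, so the invariant
   form tr (X Y) is positive semidefinite on s. Its radical N is an ideal of
   nilpotent matrices, and D is skew on s / N, so having real spectrum it
   vanishes there: [s, s] is contained in N. By Engel's theorem the common kernel
   of N is nonzero; s acts on it by commuting operators with real spectra. *)
Require Import Defs.
From mathcomp Require Import spectral zify ring lra boolp.

Set Implicit Arguments.
Unset Strict Implicit.
Unset Printing Implicit Defensive.

Import Order.TTheory GRing.Theory Num.Theory.
Import passmx.

Local Open Scope ring_scope.

(** * Matrices with real spectrum *)

Lemma char_poly_conjmx (F : fieldType) n (P A : 'M[F]_n) :
  P \in unitmx -> char_poly (P *m A *m invmx P) = char_poly A.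
Proof.
move=> uP; rewrite /char_poly.
have -> : char_poly_mx (P *m A *m invmx P) =
    map_mx polyC P *m char_poly_mx A *m map_mx polyC (invmx P).
  rewrite /char_poly_mx !map_mxM mulmxBr mulmxBl scalar_mxC -(mulmxA 'X%:M).
  by rewrite -(map_mxM _ P (invmx P)) mulmxV // map_mx1 mulmx1.
by rewrite !det_mulmx mulrAC -det_mulmx -map_mxM mulmxV // map_mx1 det1 mul1r.
Qed.

Lemma trig_mulmx_diag (F : fieldType) n (A B : 'M[F]_n) (i : 'I_n) :
  is_trig_mx A -> is_trig_mx B -> (A *m B) i i = A i i * B i i.
Proof.
move=> /is_trig_mxP tA /is_trig_mxP tB.
rewrite mxE (bigD1 i) //= big1 ?addr0 // => j nji.
case: (ltngtP i j) => [ij|ji|/val_inj ij]; last by rewrite ij eqxx in nji.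
  by rewrite tA // mul0r.
by rewrite tB // mulr0.
Qed.

Definition real_eigenvalues (R : rcfType) n (A : 'M[R]_n) :=
  forall z : R[i], eigenvalue (map_mx (real_complex R) A) z ->
  exists r : R, z = real_complex R r.

(** Over [R[i]] the matrix is unitarily triangularizable; the diagonal entries of the triangular
    form are eigenvalues, hence real. They serve as [l], and both identities are read off the
    diagonal. *)
Lemma real_eigenvalues_split (R : rcfType) n (A : 'M[R]_n) :
  real_eigenvalues A -> exists2 l : seq R,
    char_poly A = \prod_(r <- l) ('X - r%:P) &
    \tr (A *m A) = \sum_(r <- l) r ^+ 2.
Proof.
case: n A => [|n] A realA.
  exists [::]; rewrite !big_nil; first by rewrite /char_poly det_mx00.
  by rewrite /mxtrace big_ord0.
have [//|P Punitary] := Schur (map_mx (real_complex R) A).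
have uP := unitarymx_unit Punitary.
rewrite /similar_to conjumx //.
set T := _ *m invmx P => trigT.
have cT : char_poly T = map_poly (real_complex R) (char_poly A).
  by rewrite char_poly_conjmx // map_char_poly.
have [l Tl] : exists l : 'I_n.+1 -> R, forall i, T i i = real_complex R (l i).
  apply: (@fin_all_exists _ (fun=> R) (fun i r => T i i = real_complex R r)).
  move=> i; apply: realA; rewrite eigenvalue_root_char -map_char_poly -cT.
  by rewrite char_poly_trig // (bigD1 i) //= rootM root_XsubC eqxx.
exists [seq l i | i <- index_enum 'I_n.+1].
  apply: (@map_poly_inj _ _ (real_complex R)); rewrite -cT char_poly_trig //.
  rewrite big_map rmorph_prod /=; apply: eq_bigr => i _.
  by rewrite rmorphB /= map_polyX map_polyC /= Tl.
apply: (fmorph_inj (real_complex R)); rewrite -trace_map_mx map_mxM.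
have -> : map_mx (real_complex R) A *m map_mx (real_complex R) A =
    invmx P *m (T *m T *m P).
  by rewrite /T !mulmxA mulVmx // mul1mx !mulmxKV.
rewrite mxtrace_mulC mulmxK // /mxtrace big_map rmorph_sum /=.
by apply: eq_bigr => i _; rewrite trig_mulmx_diag // Tl rmorphXn expr2.
Qed.

(** The fold multiplies [V] by the characteristic polynomial evaluated at [A], so Cayley-Hamilton
    applies. *)
Lemma real_eigenvalues_annihilate (R : rcfType) n (A : 'M[R]_n) :
  real_eigenvalues A -> exists l : seq R, forall m (V : 'M_(m, n)),
  foldr (fun r W => W *m A - r *: W) V l = 0.
Proof.
case: n A => [|n] A; first by exists [::] => m V; rewrite /= thinmx0.
case/real_eigenvalues_split=> l cA _; exists l => m V.
have -> : foldr (fun r W => W *m A - r *: W) V l =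
    V *m horner_mx A (\prod_(r <- l) ('X - r%:P)).
  elim: {cA} l => [|r l IH] /=; first by rewrite big_nil rmorph1 mulmx1.
  rewrite IH big_cons mulrC rmorphM /= mulmxA rmorphB /= horner_mx_X horner_mx_C.
  by rewrite mulmxBr mul_mx_scalar.
by rewrite -cA Cayley_Hamilton mulmx0.
Qed.

(* The hypotheses on N say that D, acting on S / N, has no nonzero eigenvalue in R
   and no Jordan block at 0. *)
Lemma strip_real_roots (R : fieldType) (V : lmodType R) (S N : V -> Prop)
    (D : V -> V) (l : seq R) x :
  linear D ->
  (forall y, S y -> S (D y)) ->
  (forall a y z, S y -> S z -> S (a *: y + z)) ->
  (forall y, N y -> N (D y)) ->
  (forall r y, S y -> r != 0 -> N (D y - r *: y) -> N y) ->
  (forall y, S y -> N (D (D y)) -> N (D y)) ->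
  S x -> N (foldr (fun r y => D y - r *: y) x l) -> N (D x).
Proof.
move=> Dlin SD Slin ND Nshift Nsq; set f := fun r y => _.
have Sf k y : S y -> S (foldr f y k).
  move=> Sy; elim: k => //= r k IH.
  by rewrite /f addrC -scaleNr; apply: Slin => //; apply: SD.
have Df k y : D (foldr f y k) = foldr f (D y) k.
  by elim: k => //= r k <-; rewrite /f -!scaleNr ![_ + - r *: _]addrC Dlin.
elim: l x => [|r l IH] x Sx /=; first exact: ND.
(* For r = 0 the factor [D] is moved inside to act on [x]; induction gives [N (D (D x))], and [Nsq]
   removes one [D]. A nonzero factor is dropped by [Nshift]. *)
have [->|nr0] := eqVneq r 0.
  by rewrite {1}/f scale0r subr0 Df => /IH h; apply: Nsq => //; apply: h; apply: SD.
by move=> /Nshift h; apply: IH => //; apply: h => //; apply: Sf.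
Qed.

(** * Common kernels of nilpotent 3 by 3 matrices *)

Definition commmx (R : fieldType) n (X Y : 'M[R]_n) := X *m Y - Y *m X.

(** Invariance of the trace form: it makes the radical an ideal and commutation with a fixed matrix
    a skew operator. *)
Lemma mxtrace_commmx (R : fieldType) n (X Y Z : 'M[R]_n) :
  \tr (commmx X Y *m Z) = \tr (X *m commmx Y Z).
Proof.
rewrite /commmx mulmxBl mulmxBr !(raddfB (@mxtrace R n)) /= !mulmxA; congr (_ - _).
by rewrite -(mulmxA Y) mxtrace_mulC.
Qed.

(* Here X Y = - Y X on N, and each nonzero A in N has rank 1, so X in N maps the
   line im A into itself; as X is nilpotent it kills that line. *)
Lemma square_zero_common_kernel (R : realFieldType) (N : 'M[R]_3 -> Prop) :
  (forall X Y, N X -> N Y -> N (X + Y)) -> (forall X, N X -> X *m X = 0) ->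
  exists2 u : 'rV[R]_3, u != 0 & forall X, N X -> u *m X = 0.
Proof.
move=> ND N2; have [[A NA nzA]|N0] := EM (exists2 A, N A & A != 0); last first.
  exists (delta_mx 0 0); first by apply/eqP => /matrixP/(_ 0 0)/eqP; rewrite !mxE oner_eq0.
  by move=> X NX; have [->|nzX] := eqVneq X 0; [rewrite mulmx0 | case: N0; exists X].
(* Sylvester's inequality gives 2 rank A - 3 <= rank (A^2) = 0. *)
have rkA : \rank A = 1%N.
  have := mxrank_mul_min A A; rewrite N2 // mxrank0; move: nzA; rewrite -mxrank_eq0.
  by have := rank_leq_row A; case: (\rank A) => [|[|[|[|]]]].
have [i nzi] : exists i, row i A != 0.
  apply: contrapT => h; case/eqP: nzA; apply/row_matrixP => i; rewrite row0.
  by apply: contrapT => /eqP nzi; apply: h; exists i.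
exists (row i A) => // X NX.
have anti : A *m X = - (X *m A).
  have := N2 _ (ND _ _ NA NX); rewrite mulmxDl !mulmxDr !N2 // addr0 add0r.
  by move/eqP; rewrite addr_eq0 => /eqP.
have eqA : (row i A :=: A)%MS.
  apply/eqmxP; rewrite -(mxrank_leqif_eq (row_sub i A)) eqn_leq mxrankS ?row_sub //.
  by rewrite rkA lt0n mxrank_eq0.
have /sub_rVP[c cE] : (row i A *m X <= row i A)%MS.
  by rewrite eqA -row_mul anti -mulNmx row_mul submxMl.
have : c ^+ 2 *: row i A = 0.
  by rewrite expr2 -scalerA -cE scalemxAl -cE -mulmxA N2 // mulmx0.
by move/eqP; rewrite scaler_eq0 (negPf nzi) orbF sqrf_eq0 cE => /eqP ->; rewrite scale0r.
Qed.

Lemma mxtrace_cubeD (R : fieldType) n (A B : 'M[R]_n) :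
  \tr ((A + B) *m (A + B) *m (A + B)) = \tr (A *m A *m A) +
  \tr (A *m A *m B) *+ 3 + \tr (A *m B *m B) *+ 3 + \tr (B *m B *m B).
Proof.
rewrite !mulmxDl !mulmxDr !mulmxDl !linearD /=.
rewrite (mxtrace_mulC (B *m A) A) (mxtrace_mulC (B *m A) B) !mulmxA.
by rewrite (mxtrace_mulC (A *m B) A) (mxtrace_mulC (B *m B) A) !mulmxA; ring.
Qed.

Lemma mxtrace3 (R : fieldType) (A : 'M[R]_3) :
  \tr A = A 0 0 + A 1 1 + A (1 + 1) (1 + 1).
Proof.
rewrite /mxtrace !big_ord_recl big_ord0 addr0 addrA.
by congr (_ + A _ _ + A _ _); apply/val_inj.
Qed.

Lemma mulmx3 (R : fieldType) m n (A : 'M[R]_(m, 3)) (B : 'M[R]_(3, n)) i j :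
  (A *m B) i j = A i 0 * B 0 j + A i 1 * B 1 j + A i (1 + 1) * B (1 + 1) j.
Proof.
rewrite mxE !big_ord_recl big_ord0 addr0 addrA.
by congr (_ + A i _ * B _ j + A i _ * B _ j); apply/val_inj.
Qed.

(** Engel's theorem in dimension 3, by hand. If all squares vanish, the previous case applies;
    otherwise some [A] is a single Jordan block, and the line im A^2 is killed by all of [N]. *)
Lemma nilpotent_common_kernel (R : realFieldType) (N : 'M[R]_3 -> Prop) :
  (forall X Y, N X -> N Y -> N (X + Y)) ->
  (forall X Y, N X -> N Y -> N (X - Y)) ->
  (forall X Y, N X -> N Y -> N (commmx X Y)) ->
  (forall X, N X -> \tr (X *m X) = 0) ->
  (forall X, N X -> X *m X *m X = 0) ->
  exists2 u : 'rV[R]_3, u != 0 & forall X, N X -> u *m X = 0.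
Proof.
move=> ND NB Nlie Ntr2 N3.
have [[A NA nzA2]|N2] := EM (exists2 A, N A & A *m A != 0); last first.
  apply: (square_zero_common_kernel ND) => X NX.
  by apply: contrapT => /eqP nz; apply: N2; exists X.
have [w nzw] : exists w : 'rV_3, w *m A *m A != 0.
  apply: contrapT => h; case/eqP: nzA2; apply/row_matrixP => i.
  rewrite row0 row_mul rowE; apply: contrapT => /eqP nzi.
  by apply: h; exists (delta_mx 0 i).
have A3 (v : 'rV_3) : v *m A *m A *m A = 0 by rewrite -!mulmxA (mulmxA A) N3 // mulmx0.
(* In the basis w, wA, wA^2 the matrix A becomes the shift J, and vanishing of
   tr (J^2 B), tr [J, B]^2 and tr B^2 forces the last row of B to be zero. *)
exists (w *m A *m A) => // B NB'.
pose P : 'M[R]_3 := \matrix_(i < 3) nth 0 [:: w; w *m A; w *m A *m A] i.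
pose J : 'M[R]_3 := \matrix_(i, j) (j == i.+1 :> nat)%:R.
have rP v : v *m P = v 0 0 *: w + v 0 1 *: (w *m A) + v 0 (1 + 1) *: (w *m A *m A).
  rewrite mulmx_sum_row !big_ord_recl big_ord0 !rowK /= addr0 addrA.
  by congr (_ + _ *: _ + _ *: _); congr (v 0 _); apply/val_inj.
(* Applying A^2, then A, to a vanishing combination isolates its coefficients in turn. *)
have uP : P \in unitmx.
  rewrite -row_free_unit; apply: inj_row_free => v; rewrite rP => v0.
  have := congr1 (fun u => u *m A *m A) v0.
  rewrite /= !mulmxDl -!scalemxAl !A3 !mul0mx !scaler0 !addr0 => /eqP.
  rewrite scaler_eq0 (negPf nzw) orbF => /eqP v00.
  have := congr1 (fun u => u *m A) v0.
  rewrite /= !mulmxDl -!scalemxAl !A3 !mul0mx !scaler0 !addr0 v00 scale0r add0r => /eqP.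
  rewrite scaler_eq0 (negPf nzw) orbF => /eqP v01.
  move/eqP: v0; rewrite v00 v01 !scale0r !add0r.
  rewrite scaler_eq0 (negPf nzw) orbF => /eqP v02.
  apply/rowP => -[[|[|[|//]]] ?]; rewrite mxE; [rewrite -[RHS]v00 | rewrite -[RHS]v01 |
    rewrite -[RHS]v02]; congr (v 0 _); exact/val_inj.
have PA : P *m A = J *m P.
  apply/row_matrixP => i; rewrite !row_mul rP rowK !mxE.
  case: i => -[|[|[|//]]] ? /=;
    by rewrite ?A3 ?scale0r ?scale1r ?add0r ?addr0.
pose conj X := P *m X *m invmx P.
have conjM X Y : conj X *m conj Y = conj (X *m Y) by rewrite /conj !mulmxA mulmxKV.
have tr_conj X : \tr (conj X) = \tr X by rewrite mxtrace_mulC mulKmx.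
have conjA : conj A = J by rewrite /conj PA mulmxK.
have tr3 X : N X -> \tr (X *m X *m X) = 0 by move=> NX; rewrite N3 // mxtrace0.
have trAAB : \tr (A *m A *m B) = 0.
  (* Expand tr (A + B)^3 = tr (A - B)^3 = 0. *)
  have := tr3 _ (ND _ _ NA NB'); have := tr3 _ (NB _ _ NA NB').
  rewrite !mxtrace_cubeD !mulmxN !mulNmx !opprK !(raddfN (@mxtrace R 3)) /=.
  rewrite !(tr3 _ NA) !(tr3 _ NB').
  by move=> h1 h2; lra.
have subE (X Y : 'M[R]_3) i j : (X - Y) i j = X i j - Y i j by rewrite !mxE.
have JE i j : J i j = (j == i.+1 :> nat)%:R by rewrite mxE.
have := trAAB; rewrite -tr_conj -!conjM conjA.
have /Ntr2 := Nlie _ _ NA NB'.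
rewrite -tr_conj -conjM.
have -> : conj (commmx A B) = commmx J (conj B).
  by rewrite /commmx -conjA !conjM /conj mulmxBr mulmxBl.
have := Ntr2 _ NB'; rewrite -tr_conj -conjM.
have : w *m A *m A *m B = row (1 + 1) (conj B) *m P.
  by rewrite -row_mul /conj mulmxKV // row_mul rowK.
move=> ->; move: (conj B) => M.
rewrite rP ![row _ _ _ _]mxE.
rewrite /commmx !mxtrace3 !mulmx3 !subE !mulmx3 !JE /=.
set m00 := M 0 0; set m01 := M 0 1; set m02 := M 0 (1 + 1).
set m10 := M 1 0; set m11 := M 1 1; set m12 := M 1 (1 + 1).
set m20 := M (1 + 1) 0; set m21 := M (1 + 1) 1; set m22 := M (1 + 1) (1 + 1).
move=> hM hC hJ.
have sq3 (a b c : R) : a ^+ 2 + b ^+ 2 + c ^+ 2 = 0 -> c = 0.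
  by move/eqP; rewrite paddr_eq0 ?addr_ge0 ?sqr_ge0 // sqrf_eq0 => /andP[_ /eqP].
(* The only nonzero entry of J^2 is at (0, 2), so tr (J^2 M) = m20. *)
have z20 : m20 = 0 by rewrite -hJ; ring.
move: hM hC; rewrite z20 => hM hC.
(* With m20 = 0, [J, M] is upper triangular with diagonal m10, m21 - m10, -m21, so the trace of its
   square is a sum of squares. *)
have z21 : m21 = 0 by apply: (sq3 m10 (m21 - m10)); rewrite -hC; ring.
have z10 : m10 = 0 by apply: (sq3 m21 (m21 - m10)); rewrite -hC; ring.
(* Now [M] itself is upper triangular and tr (M^2) is the sum of the squares of its diagonal
   entries. *)
have z22 : m22 = 0.
  by apply: (sq3 m00 m11); rewrite -hM z10 z21; ring.
by rewrite z21 z22 !scale0r !addr0.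
Qed.

(** * The case of a non-real eigenvalue *)

Lemma commmx_linearl (R : fieldType) n (A : 'M[R]_n) : linear (fun Y => commmx Y A).
Proof.
move=> a Y Z; rewrite /commmx mulmxDl mulmxDr -scalemxAl -scalemxAr.
by rewrite scalerBr opprD addrACA.
Qed.

(** Conjugation preserves the roots of a real polynomial, so z and its conjugate are two of the
    three; the third is the trace minus 2 Re z, which is real. *)
Lemma nonreal_char_poly (R : rcfType) (A : 'M[R]_3) (z : R[i]) :
  eigenvalue (map_mx (real_complex R) A) z -> conjc z != z -> exists c : R,
  char_poly (map_mx (real_complex R) A) =
    \prod_(t <- [:: z; conjc z; real_complex R c]) ('X - t%:P).
Proof.
set Ac := map_mx _ A; rewrite eigenvalue_root_char => rz nrz.
have rzc : root (char_poly Ac) (conjc z).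
  rewrite -complex_root_conj -map_char_poly -map_poly_comp /=.
  rewrite (@eq_map_poly _ _ _ (real_complex R)) ?map_char_poly // => x /=.
  exact: conjc_real.
have [r pr] := closed_field_poly_normal (char_poly Ac).
rewrite (monicP (char_poly_monic Ac)) scale1r in pr.
have szr : size r = 3%N by apply: succn_inj; rewrite -(size_prod_XsubC r id) -pr size_char_poly.
rewrite pr !root_prod_XsubC in rz rzc.
have pz := perm_to_rem rz.
move: rzc; rewrite (perm_mem pz) inE (negPf nrz) /= => rzc.
have pzc := perm_to_rem rzc.
have : perm_eq r (z :: conjc z :: rem (conjc z) (rem z r)).
  by rewrite (permPl pz) perm_cons.
case: (rem _ (rem _ _)) => [|t [|t' q]] pt; have := perm_size pt; rewrite szr // => _.
exists (\tr A - complex.Re z *+ 2).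
suff -> : real_complex R (\tr A - complex.Re z *+ 2) = t by rewrite pr (perm_big _ pt).
have := @coefPn_prod_XsubC _ r; rewrite szr -pr char_poly_trace // => /(_ isT) /oppr_inj.
rewrite (perm_big _ pt) /= !big_cons big_nil addr0 trace_map_mx addrA addcJ => trE.
by rewrite rmorphB rmorphMn /= trE mulr_natl addrAC subrr add0r.
Qed.

(** The three eigenvalues have distinct imaginary parts b, -b, 0. So they are distinct, and a real
    difference of two of them must be 0. *)
Lemma nonreal_diagonalizable (R : rcfType) (A : 'M[R]_3) (z : R[i]) :
  eigenvalue (map_mx (real_complex R) A) z -> conjc z != z -> exists P d,
  [/\ P \in unitmx, P *m map_mx (real_complex R) A = diag_mx d *m P &
   forall (i j : 'I_3) (r : R), d 0 i - d 0 j = real_complex R r -> r = 0].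
Proof.
set Ac := map_mx _ A => rz nrz; have [c pA] := nonreal_char_poly rz nrz.
set rs := [:: _; _; _] in pA.
have nzc t : conjc t != t -> (t == real_complex R c) = false.
  by apply: contraNF => /eqP ->; rewrite conjc_real.
have [|P uP] := (diagonalizableP Ac).2.
  exists rs; last by rewrite -pA mxminpoly_dvd_char.
  by rewrite /= !inE eq_sym (negPf nrz) !nzc ?conjcK // eq_sym.
rewrite /similar_to => /is_diag_mxP dP; rewrite conjumx // in dP.
pose d := \row_i (P *m Ac *m invmx P) i i.
have PA : P *m Ac = diag_mx d *m P.
  rewrite -[LHS](mulmxKV uP); congr (_ *m P); apply/matrixP => i j.
  have [->|nij] := eqVneq i j; first by rewrite [RHS]mxE [d _ _]mxE eqxx.
  by rewrite [RHS]mxE (negPf nij) dP.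
exists P, d; split=> // i j r.
have drs k : d 0 k \in rs.
  rewrite -root_prod_XsubC -pA -eigenvalue_root_char; apply/eigenvalueP; exists (row k P).
    by rewrite -row_mul PA mul_diag_mx; apply/rowP => ?; rewrite !mxE.
  rewrite rowE; apply: contraTneq isT => /(canRL (mulmxK uP)).
  by rewrite mul0mx => /matrixP/(_ 0 k)/eqP; rewrite !mxE !eqxx oner_eq0.
move=> E; have Im0 : complex.Im (d 0 i) = complex.Im (d 0 j).
  by move/eqP: E; case: (d 0 i) (d 0 j) => [a b] [e f]; rewrite eq_complex /= => /andP[_];
    rewrite subr_eq0 => /eqP.
have imz : complex.Im z != 0.
  apply: contraNneq nrz; case: z {rz rs pA drs} => [a b] /= ->.
  by rewrite eq_complex /= oppr0 !eqxx.
have Im_inj : {in rs &, injective (fun t => complex.Im t)}.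
  move: imz; rewrite /rs; case: (z) => [a b] /= nb t t'; rewrite !inE.
  move=> /or3P[] /eqP -> /or3P[] /eqP -> //= bE; case/eqP: nb; lra.
move: E; rewrite (Im_inj _ _ (drs i) (drs j) Im0) subrr => /esym/eqP.
by rewrite fmorph_eq0 => /eqP.
Qed.

Lemma nonreal_commmx_eq0 (R : rcfType) (A X : 'M[R]_3) (z : R[i]) (l : seq R) :
  eigenvalue (map_mx (real_complex R) A) z -> conjc z != z ->
  foldr (fun r Y => commmx Y A - r *: Y) X l = 0 -> commmx X A = 0.
Proof.
move=> ez nrz; have [P [d [uP PA dreal]]] := nonreal_diagonalizable ez nrz.
set Ac := map_mx _ A in PA.
pose T Y := P *m map_mx (real_complex R) Y *m invmx P.
have T0 Y : T Y = 0 -> Y = 0.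
  move=> TY; apply: (@map_mx_inj _ _ (real_complex R)); rewrite map_mx0.
  apply: (can_inj (mulKmx uP)); rewrite mulmx0.
  by apply: (can_inj (mulmxK (etrans (unitmx_inv P) uP))); rewrite mul0mx.
have TB Y Z : T (Y - Z) = T Y - T Z by rewrite /T map_mxB mulmxBr mulmxBl.
have TZ r Y : T (r *: Y) = real_complex R r *: T Y.
  by rewrite /T map_mxZ -scalemxAr -scalemxAl.
have TM Y Z : T (Y *m Z) = T Y *m T Z.
  by rewrite /T map_mxM !mulmxA mulmxKV.
have TA : T A = diag_mx d by rewrite /T PA mulmxK.
(* In an eigenbasis of [A], commutation with [A] scales each matrix entry by a difference of
   eigenvalues. Hence it is semisimple with no nonzero real eigenvalue, and [strip_real_roots]
   applies with the zero subspace as [N]. *)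
have Tcomm Y i j : T (commmx Y A) i j = (d 0 j - d 0 i) * T Y i j.
  rewrite /commmx TB !TM TA; move: (T Y) => M.
  by rewrite mul_mx_diag mul_diag_mx !mxE mulrBl (mulrC (M i j)).
have comm0 Y : (forall i j, T (commmx Y A) i j = 0) -> commmx Y A = 0.
  by move=> h; apply: T0; apply/matrixP => i j; rewrite h mxE.
apply: (@strip_real_roots _ _ (fun _ => True) (fun Y => Y = 0) (fun Y => commmx Y A) l) => //.
- exact: commmx_linearl.
- by move=> ? ->; rewrite /commmx mul0mx mulmx0 subrr.
- move=> r Y _ nr0 /(congr1 T); rewrite TB TZ => E.
  apply: T0; apply/matrixP => i j; move/matrixP/(_ i j)/eqP: E.
  have -> : T 0 = 0 by rewrite /T map_mx0 mulmx0 mul0mx.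
  rewrite [_ i j]mxE [X in _ + X]mxE [X in _ - X]mxE Tcomm -mulrBl [X in _ == X]mxE.
  rewrite mulf_eq0 subr_eq0 => /orP[/eqP /dreal r0|/eqP ->]; last by rewrite mxE.
  by rewrite r0 eqxx in nr0.
- move=> Y _ E; apply: comm0 => i j.
  have := Tcomm (commmx Y A) i j; rewrite E.
  have -> : T 0 i j = 0 by rewrite /T map_mx0 mulmx0 mul0mx mxE.
  rewrite Tcomm mulrA => /esym/eqP; rewrite mulf_eq0 mulf_eq0 orbb => /orP[]/eqP->.
    by rewrite mul0r.
  by rewrite mulr0.
Qed.

(** Three nonzero eigenspaces in direct sum in dimension 3 are lines. The real one is already a line
    over [R], as rank is unchanged by field extension, and whatever commutes with [A] preserves
    it. *)
Lemma nonreal_common_eigenvector (R : rcfType) (A : 'M[R]_3) (z : R[i]) :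
  eigenvalue (map_mx (real_complex R) A) z -> conjc z != z ->
  exists2 u : 'rV[R]_3, u != 0 &
  forall X, commmx X A = 0 -> exists a, u *m X = a *: u.
Proof.
set Ac := map_mx _ A => ez nrz; have [c pA] := nonreal_char_poly ez nrz.
have ev t : t \in [:: z; conjc z; real_complex R c] -> eigenvalue Ac t.
  by move=> tin; rewrite eigenvalue_root_char pA root_prod_XsubC.
have rk_gt0 t : t \in [:: z; conjc z; real_complex R c] ->
  (0 < \rank (eigenspace Ac t))%N by move=> /ev; rewrite lt0n mxrank_eq0.
have nzc t : conjc t != t -> (t == real_complex R c) = false.
  by apply: contraNF => /eqP ->; rewrite conjc_real.
pose a_ := tnth [tuple z; conjc z; real_complex R c].
have a_inj : injective a_.
  apply/tuple_uniqP.
  by rewrite /= !inE eq_sym (negPf nrz) !nzc ?conjcK // eq_sym.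
have /mxdirectP/= dir := @mxdirect_sum_eigenspace _ _ _ Ac xpredT a_ (in2W a_inj).
have := rank_leq_row (\sum_i eigenspace Ac (a_ i))%MS.
rewrite dir !big_ord_recl big_ord0 /a_ !(tnth_nth 0) /= => rk3.
have rk1 : \rank (eigenspace A c) = 1%N.
  have := rk_gt0 z; have := rk_gt0 (conjc z); have := rk_gt0 (real_complex R c).
  rewrite !inE !eqxx !orbT /= => /(_ isT) h1 /(_ isT) h2 /(_ isT) h3.
  have <- : \rank (eigenspace Ac (real_complex R c)) = \rank (eigenspace A c).
    by rewrite -map_eigenspace mxrank_map.
  lia.
have [u uE nzu] : exists2 u : 'rV_3, (u <= eigenspace A c)%MS & u != 0.
  have /rowV0Pn[u ? ?] : eigenspace A c != 0 by rewrite -mxrank_eq0 rk1.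
  by exists u.
exists u => // X /eqP; rewrite subr_eq0 => /eqP XA.
have eqE : (u :=: eigenspace A c)%MS.
  apply/eqmxP; rewrite -(mxrank_leqif_eq uE) eqn_leq mxrankS //.
  by rewrite rk1 lt0n mxrank_eq0.
apply/sub_rVP; rewrite eqE; apply/eigenspaceP.
by rewrite -mulmxA XA mulmxA (eigenspaceP uE) scalemxAl.
Qed.

(** * Common eigenvectors and the case of real spectra *)

Lemma annihilated_eigenvector (R : fieldType) n m (A : 'M[R]_n) (U : 'M_(m, n)) (l : seq R) :
  (U *m A <= U)%MS -> U != 0 ->
  (forall V : 'M_(m, n), foldr (fun r W => W *m A - r *: W) V l = 0) ->
  exists a, (U :&: eigenspace A a)%MS != 0.
Proof.
move=> UA nzU /(_ U) fl0; set f := fun r W => _ in fl0.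
have sub k : (foldr f U k <= U)%MS.
  elim: k => //= r k IH; rewrite addmx_sub ?eqmx_opp ?scalemx_sub //.
  by apply: submx_trans UA; apply: submxMr.
(* Some nonzero partial product is killed by the next factor [A - r]; its rows lie in [U] and in the
   eigenspace of r. *)
elim: l fl0 => [|r l IH] /=; first by move/eqP; rewrite (negPf nzU).
have [/IH //|nz] := eqVneq (foldr f U l) 0.
move/eqP; rewrite subr_eq0 => /eqP /eigenspaceP E; exists r.
apply: contraNneq nz => /eqP; rewrite -!submx0; apply: submx_trans.
by rewrite sub_capmx sub E.
Qed.

(** Induction on the rank of [U]. If some [A] is not scalar on [U], then [U] is cut down to an
    eigenspace of [A], which stays stable because the operators commute on [U]. *)
Lemma commuting_common_eigenvector (R : fieldType) n (S : 'M[R]_n -> Prop) (U : 'M_n) :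
  (forall A, S A -> exists l : seq R, forall V : 'M_n,
    foldr (fun r W => W *m A - r *: W) V l = 0) ->
  U != 0 -> (forall A, S A -> (U *m A <= U)%MS) ->
  (forall A B, S A -> S B -> U *m commmx A B = 0) ->
  exists2 u : 'rV_n, u != 0 & forall A, S A -> exists a, u *m A = a *: u.
Proof.
move=> Sann; have [k] := ubnP (\rank U); elim: k U => // k IH U rkU nzU US UC.
have [scal|] := EM (forall A, S A -> exists a, U *m A = a *: U).
  have /rowV0Pn[u /submxP[v ->] nzu] : U != 0 by [].
  exists (v *m U) => // A /scal[a UA]; exists a.
  by rewrite -mulmxA UA scalemxAr.
move/existsNP=> [A /not_implyP[SA noeig]].
have [l /annihilated_eigenvector ann] := Sann _ SA.
have [a nzW] := ann _ (US _ SA) nzU.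
have WU : ((U :&: eigenspace A a)%MS <= U)%MS by apply: capmxSl.
apply: IH nzW _ _.
- rewrite -ltnS; apply: leq_trans rkU; rewrite ltnS ltn_neqAle mxrankS // andbT.
  apply: contra_notN noeig; rewrite (mxrank_leqif_eq WU) => /eqmxP WUe; exists a.
  by apply/eigenspaceP; rewrite -WUe capmxSr.
- move=> B SB; rewrite sub_capmx; apply/andP; split.
    by apply: submx_trans (US _ SB); apply: submxMr.
  apply/eigenspaceP; have /submxP[M WM] := WU.
  have /eqP := UC _ _ SA SB; rewrite mulmxBr subr_eq0 !mulmxA => /eqP AB.
  rewrite {1}WM -!mulmxA (mulmxA U) -AB !mulmxA -WM.
  by rewrite (eigenspaceP (capmxSr U _)) scalemxAl.
- by move=> B C SB SC; have /submxP[M ->] := WU; rewrite -mulmxA UC // mulmx0.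
Qed.

(** [N] is an arbitrary predicate, so the kernel is obtained by enlarging a subspace killed by [N]
    until it is maximal; the codimension bounds the number of enlargements. *)
Lemma common_kernel (R : fieldType) n (N : 'M[R]_n -> Prop) :
  exists U : 'M[R]_n, (forall X, N X -> U *m X = 0) /\
  forall m (V : 'M_(m, n)), (forall X, N X -> V *m X = 0) -> (V <= U)%MS.
Proof.
pose K m (V : 'M[R]_(m, n)) := forall X, N X -> V *m X = 0.
suff ind k U : (n - \rank U < k)%N -> K n U ->
    exists U : 'M[R]_n, K n U /\ forall m (V : 'M_(m, n)), K m V -> (V <= U)%MS.
  by apply: (ind n.+1 0); rewrite ?mxrank0 ?subn0 // => X _; rewrite mul0mx.
elim: k U => // k IH U rkU KU.
have [Umax|] := EM (forall m (V : 'M_(m, n)), K m V -> (V <= U)%MS); first by exists U.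
move/existsNP=> [m /existsNP[V /not_implyP[KV /negP VU]]].
have UUV : (U <= U + V)%MS by apply: addsmxSl.
apply: (IH (U + V)%MS).
  have : (\rank U < \rank (U + V)%MS)%N.
    rewrite ltn_neqAle mxrankS // andbT (mxrank_leqif_eq UUV).
    by apply: contra VU => /eqmxP ->; apply: addsmxSr.
  by have := rank_leq_row (U + V)%MS; lia.
move=> X NX; apply/eqP; rewrite -submx0 addsmxMr addsmx_sub KU // KV //.
by rewrite !sub0mx.
Qed.

(** A vanishing sum of squares of real eigenvalues makes the characteristic polynomial X^3;
    Cayley-Hamilton concludes. *)
Lemma trace_square_eq0 (R : rcfType) (A : 'M[R]_3) :
  real_eigenvalues A -> \tr (A *m A) = 0 -> A *m A *m A = 0.
Proof.
case/real_eigenvalues_split => l cA ->; move/eqP.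
rewrite psumr_eq0 => [/allP l0|r _]; last exact: sqr_ge0.
have sl : size l = 3%N by apply: succn_inj; rewrite -(size_prod_XsubC l id) -cA size_char_poly.
have ln : l = nseq 3 0.
  by rewrite -sl; apply/all_pred1P/allP => r /l0 /=; rewrite sqrf_eq0.
have := Cayley_Hamilton A; rewrite cA ln big_nseq /= !rmorphM /= rmorphB /= horner_mx_X.
by rewrite polyC0 rmorph0 subr0 rmorph1 mulr1 => <-; rewrite -mulmxA.
Qed.

Lemma real_case_common_eigenvector (R : rcfType) (S : 'M[R]_3 -> Prop) :
  (forall a X Y, S X -> S Y -> S (a *: X + Y)) ->
  (forall X Y, S X -> S Y -> S (commmx X Y)) ->
  (forall A, S A -> exists l : seq R, forall X, S X ->
    foldr (fun r Y => commmx Y A - r *: Y) X l = 0) ->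
  (forall A, S A -> real_eigenvalues A) ->
  exists2 u : 'rV_3, u != 0 & forall A, S A -> exists a, u *m A = a *: u.
Proof.
move=> Slin Slie Sann Sreal.
have SD X Y : S X -> S Y -> S (X + Y) by move=> ? ?; rewrite -[X]scale1r; apply: Slin.
have SB X Y : S X -> S Y -> S (X - Y).
  by move=> ? ?; rewrite addrC -scaleN1r; apply: Slin.
have S0 X : S X -> S 0 by move=> SX; rewrite -(subrr X); apply: SB.
have trC (X Y : 'M[R]_3) : \tr (X *m Y) = \tr (Y *m X) by exact: mxtrace_mulC.
have tr_ge0 X : S X -> 0 <= \tr (X *m X).
  move=> /Sreal /real_eigenvalues_split[l _ ->].
  by apply: sumr_ge0 => r _; apply: sqr_ge0.
(* As the form is positive semidefinite on [S], its isotropic elements constitute its radical, which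
   [orth] confirms. *)
pose N X := S X /\ \tr (X *m X) = 0.
have orth X Y : N X -> S Y -> \tr (X *m Y) = 0.
  move=> [SX X0] SY; set b := \tr _; apply: contrapT => /eqP nb.
  have a0 := tr_ge0 _ SY; set a := \tr _ in a0.
  (* With t this coefficient, tr ((t X + Y)^2) = 2 t b + a = -1, a contradiction. *)
  have := tr_ge0 _ (Slin (- (a + 1) / (2 * b)) _ _ SX SY).
  rewrite mulmxDl !mulmxDr -!scalemxAl -!scalemxAr !(raddfD (@mxtrace R 3)) /= !mxtraceZ.
  rewrite X0 (trC Y) -/a -/b => h.
  have : (- (a + 1) / (2 * b)) * b = - (a + 1) / 2 by field; rewrite nb.
  by move=> e; rewrite e in h; lra.
have ND X Y : N X -> N Y -> N (X + Y).
  move=> NX NY; split; first by apply: SD; [case: NX | case: NY].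
  rewrite mulmxDl !mulmxDr !(raddfD (@mxtrace R 3)) /= (orth _ _ NX NY.1) (orth _ _ NY NX.1).
  by rewrite NX.2 NY.2 !addr0.
have NB X Y : N X -> N Y -> N (X - Y).
  move=> NX [SY Y0]; apply: ND => //; split.
    by rewrite -sub0r; apply: SB => //; apply: S0 NX.1.
  by rewrite mulmxN mulNmx opprK.
have Nlie X Y : N X -> S Y -> N (commmx X Y).
  move=> NX SY; have SXY := Slie _ _ NX.1 SY; split=> //.
  by rewrite mxtrace_commmx; apply: orth => //; apply: Slie.
have commN A B : S A -> S B -> N (commmx A B).
  move=> SA SB'; have [l lB] := Sann _ SB'.
  apply: (@strip_real_roots _ _ S N (fun Y => commmx Y B) l) => //.
  - exact: commmx_linearl.
  - by move=> Y SY; apply: Slie.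
  - by move=> Y NY; apply: Nlie.
  (* By skewness tr (D Y * Y) = 0, so pairing D Y - r Y with Y leaves -r tr (Y^2). *)
  - move=> r Y SY nr0 /orth/(_ SY) H; split=> //; move: H.
    have -> : \tr ((commmx Y B - r *: Y) *m Y) = - r * \tr (Y *m Y).
      rewrite mulmxBl (raddfB (@mxtrace R 3)) /= -scalemxAl mxtraceZ mxtrace_commmx.
      rewrite /commmx mulmxBr (raddfB (@mxtrace R 3)) /= (trC Y (Y *m B)) -mulmxA.
      by rewrite subrr sub0r mulNr.
    by move/eqP; rewrite mulf_eq0 oppr_eq0 (negPf nr0) => /eqP.
  (* By skewness tr ((D Y)^2) = -tr (Y * D (D Y)) = 0. *)
  - move=> Y SY NDD; have SDY := Slie _ _ SY SB'; split=> //.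
    rewrite mxtrace_commmx.
    have -> : commmx B (commmx Y B) = - commmx (commmx Y B) B by rewrite [RHS]opprB.
    by rewrite mulmxN (raddfN (@mxtrace R 3)) /= trC orth ?oppr0.
  by rewrite lB //; split; [apply: S0 SA | rewrite mul0mx mxtrace0].
have [u0 nzu0 u0N] : exists2 u : 'rV[R]_3, u != 0 & forall X, N X -> u *m X = 0.
  apply: nilpotent_common_kernel => // [X Y NX [SY _]|X [] //|X [SX X0]]; first exact: Nlie.
  by apply: trace_square_eq0 => //; apply: Sreal.
have [U [UN Umax]] := common_kernel N.
apply: (@commuting_common_eigenvector _ _ S U).
- by move=> A /Sreal /real_eigenvalues_annihilate[l h]; exists l => V; apply: h.
- by apply: contraNneq nzu0 => U0; rewrite -submx0 -U0 Umax.
(* Since [N] is an ideal, U [X, A] = 0 and U X = 0 give U A X = 0; maximality puts U A inside U. *)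
- move=> A SA; apply: Umax => X NX.
  have := UN _ (Nlie _ _ NX SA); rewrite mulmxBr !mulmxA (UN _ NX) mul0mx sub0r => /eqP.
  by rewrite oppr_eq0 => /eqP.
- by move=> A B SA SB'; apply: UN; apply: commN.
Qed.

(** * From endomorphisms to matrices, and conclusion *)

Lemma lin1_mx_lie_bracket (F : fieldType) n (A B : 'End('rV[F]_n)) :
  lin1_mx (lie_bracket A B) = commmx (lin1_mx B) (lin1_mx A).
Proof.
(* Matrices act on rows from the right, which reverses products and hence the bracket. *)
apply/row_matrixP => i; rewrite !rowE mul_rV_lin1 /= lie_bracketE.
by rewrite mulmxBr !mulmxA !mul_rV_lin1.
Qed.

(** The matrix of [ad s A] in a basis of [s] has real eigenvalues, so a product of real factors
    kills all coordinate rows. This is carried over to the matrices of elements of [s], where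
    [ad s A] becomes commutation with [lin1_mx A]. *)
Lemma supersolvable_annihilate (R : rcfType) n (s : {vspace 'End('rV[R]_n)}) A :
  lie_algebra s -> supersolvable s -> A \in s ->
  exists l : seq R, forall X, X \in s ->
    foldr (fun r Y => commmx Y (lin1_mx A) - r *: Y) (lin1_mx X) l = 0.
Proof.
move=> ls ss sA; set e := vbasis {:subvs_of s}.
have be : basis_of fullv e := vbasisP _.
have [l lM] := @real_eigenvalues_annihilate _ _ (mxof e e (ad s A)) (ss _ sA).
exists l => X sX; set x : subvs_of s := vsproj s X.
have -> : X = vsval x by rewrite vsprojK.
have E k : lin1_mx (vsval (foldr (fun r y => ad s A y - r *: y) x k)) =
   foldr (fun r Y => commmx Y (lin1_mx A) - r *: Y) (lin1_mx (vsval x)) k.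
  elim: k => //= r k <-; set y := foldr _ _ _.
  apply/row_matrixP => i; rewrite !rowE mul_rV_lin1 mulmxBr -scalemxAr.
  by rewrite -lin1_mx_lie_bracket -adE // !mul_rV_lin1 /= add_lfunE opp_lfunE scale_lfunE.
rewrite -E; suff -> : foldr (fun r y => ad s A y - r *: y) x l = 0.
  by apply/row_matrixP => i; rewrite !rowE mul_rV_lin1 /= zero_lfunE mulmx0.
apply/eqP; rewrite -(rVof_eq0 be) -(lM 1%N (rVof e x)); apply/eqP.
elim: (l) => //= r k IH; rewrite linearB linearZ /= -IH.
by rewrite (rVof_app e be).
Qed.

Theorem theorem7 (R : realType) (s : {vspace 'End('rV[R]_3)})
    (hLie : lie_algebra s) (hss : supersolvable s) :
  exists u : 'rV[R]_3, u != 0 /\ forall A, A \in s -> eigenvector A u.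
Proof.
pose S M := exists2 X, X \in s & M = lin1_mx X.
have Sann A : S A -> exists l : seq R, forall X, S X ->
    foldr (fun r Y => commmx Y A - r *: Y) X l = 0.
  move=> [X sX ->]; have [l ann] := supersolvable_annihilate hLie hss sX.
  by exists l => _ [Y sY ->]; apply: ann.
suff [u nzu uS] : exists2 u : 'rV[R]_3, u != 0 &
    forall A, S A -> exists a, u *m A = a *: u.
  exists u; split=> // A sA; split=> //.
  by have [|a ua] := uS (lin1_mx A); [exists A | exists a; rewrite -mul_rV_lin1].
have [Sreal|] := EM (forall A, S A -> real_eigenvalues A).
  apply: real_case_common_eigenvector Sann Sreal.
    move=> a _ _ [X sX ->] [Y sY ->]; exists (a *: X + Y); first exact: memvD (memvZ _ sX) sY.
    apply/row_matrixP => i; rewrite !rowE mulmxDr -scalemxAr !mul_rV_lin1 /=.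
    by rewrite add_lfunE scale_lfunE.
  move=> _ _ [X sX ->] [Y sY ->]; exists (lie_bracket Y X); first exact: hLie.
  by rewrite lin1_mx_lie_bracket.
move=> /existsNP[A /not_implyP[SA /existsNP[z /not_implyP[ez nreal]]]].
have nrz : conjc z != z.
  apply: contra_notN nreal => /eqP zE; exists (complex.Re z).
  (* A self-conjugate z equals (z + z) / 2, its real part. *)
  by rewrite [RHS]ReJ_add zE -mulr2n -[X in X / _]mulr_natr mulfK ?pnatr_eq0.
have [u nzu uS] := nonreal_common_eigenvector ez nrz.
exists u => // X SX; apply: uS; have [l ann] := Sann _ SA.
exact: nonreal_commmx_eq0 ez nrz (ann _ SX).
Qed.
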